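(* Let $E$ and $F$ be Jordan-Banach triples and let $T:E\rightarrow F$ be a triple homomorphism, not assumed to be continuous. Let $(x_n)$ and $(y_n)$ be two sequences of non-zero elements in $E$ such that $x_n\perp x_m$ and $x_n\perp y_m$ for every $n\neq m$. Then $$\sup\left\{\frac{\|T(\{x_n,x_n,y_n\})\|}{\|x_n\|^2\,\|y_n\|} : n\in\mathbb{N}\right\}<\infty.$$
   Context: A real (resp., complex) Jordan-Banach triple is a real (resp., complex) Banach space $E$ with a non-trivial (jointly) continuous triple product $E\times E\times E\to E$, $(x,y,z)\mapsto\{x,y,z\}$, which is bilinear and symmetric in the outer variables $x,z$, linear (resp., conjugate linear) in the middle variable $y$, and satisfies the Jordan identity $L(a,b)L(x,y)-L(x,y)L(a,b)=L(L(a,b)x,y)-L(x,L(b,a)y)$ for all $a,b,x,y\in E$, where $L(x,y)z:=\{x,y,z\}$. Without further specification, a Jordan-Banach triple is a real or complex one. Two elements $a,b\in E$ are orthogonal, written $a\perp b$, if $L(a,b)=L(b,a)=0$. A triple homomorphism is a linear map $T$ with $T(\{a,b,c\})=\{T(a),T(b),T(c)\}$ for all $a,b,c$ (real-linear if one of the two spaces is real). *)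

(* Defs.v *)
From mathcomp Require Import all_boot all_order all_algebra.
From mathcomp Require Import all_classical all_reals all_analysis.
From mathcomp Require Import complex.
Set Implicit Arguments.
Unset Strict Implicit.
Unset Printing Implicit Defensive.
Import Order.TTheory GRing.Theory Num.Theory.
Import numFieldNormedType.Exports.
Local Open Scope classical_set_scope.
Local Open Scope ring_scope.
Local Open Scope complex_scope.

Inductive scalar_kind := RealScalars | ComplexScalars.

Definition scalars (R : realType) (k : scalar_kind) : numFieldType :=
  match k with
  | RealScalars => R
  | ComplexScalars => R[i]
  end.

Definition scalar_conj (R : realType) (k : scalar_kind) :
    scalars R k -> scalars R k :=
  match k with
  | RealScalars => id
  | ComplexScalars => @conjc R
  end.

Definition to_complex (R : realType) (k : scalar_kind) :
    scalars R k -> R[i] :=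
  match k with
  | RealScalars => fun a => a%:C
  | ComplexScalars => id
  end.

(* The norm of a normed space over K takes its values in K; over R[i] these
   values are nonnegative, hence have zero imaginary part. *)
Definition rnorm (R : realType) (k : scalar_kind)
    (E : normedModType (scalars R k)) (x : E) : R :=
  complex.Re (to_complex `|x|).

Record jordanBanachTriple (R : realType) := JordanBanachTriple {
  jbt_kind : scalar_kind;
  jbt_space :> completeNormedModType (scalars R jbt_kind);
  tprod : jbt_space -> jbt_space -> jbt_space -> jbt_space;
  tprod_nontrivial : exists x y z, tprod x y z <> 0;
  tprod_continuous :
    continuous (fun p : jbt_space * jbt_space * jbt_space =>
      tprod p.1.1 p.1.2 p.2);
  tprod_sym : forall x y z, tprod x y z = tprod z y x;
  tprod_linear_left : forall y z, linear (fun x => tprod x y z);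
  tprod_linear_right : forall x y, linear (fun z => tprod x y z);
  tprod_conj_linear_middle : forall x z (a : scalars R jbt_kind) y y',
    tprod x (a *: y + y') z =
    scalar_conj a *: tprod x y z + tprod x y' z;
  tprod_jordan : forall a b x y z,
    tprod a b (tprod x y z) - tprod x y (tprod a b z) =
    tprod (tprod a b x) y z - tprod x (tprod b a y) z
}.

Definition Lop (R : realType) (E : jordanBanachTriple R) (x y : E) : E -> E :=
  fun z => tprod x y z.

Definition orthogonal_elts (R : realType) (E : jordanBanachTriple R)
    (a b : E) : Prop :=
  (forall z, Lop a b z = 0) /\ (forall z, Lop b a z = 0).

(* Scalars a of E and b of F are identified when they are the same complex
   number: homogeneity is over R[i] when E and F are both complex, and over R
   as soon as one of the two is real. *)
Definition triple_linear (R : realType) (E F : jordanBanachTriple R)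
    (T : E -> F) : Prop :=
  (forall x y, T (x + y) = T x + T y) /\
  (forall (a : scalars R (jbt_kind E)) (b : scalars R (jbt_kind F)),
     to_complex a = to_complex b -> forall x, T (a *: x) = b *: T x).

Definition triple_homomorphism (R : realType) (E F : jordanBanachTriple R)
    (T : E -> F) : Prop :=
  triple_linear T /\
  (forall a b c, T (tprod a b c) = tprod (T a) (T b) (T c)).

(* Main.v *)
Require Import Defs.
From HB Require Import structures.
From mathcomp Require Import all_boot all_order all_algebra.
From mathcomp Require Import all_classical all_reals all_analysis.
From mathcomp Require Import complex.
Import Order.TTheory GRing.Theory Num.Theory.
Import numFieldNormedType.Exports.
Local Open Scope classical_set_scope.
Local Open Scope ring_scope.

(* A gliding-hump argument. Normalize so that |x_n|, |y_n| <= 1. If the numbers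
   |T{x_n,x_n,y_n}| were unbounded, one could extract a doubly indexed
   subfamily x_{p,q}, y_{p,q} along which they grow as fast as desired. Put
   a_p = sum_q 2^-q x_{p,q}, choose q(p) >= |T(a_p)|, and put
   b = sum_p 2^-p x_{p,q(p)}, c = sum_p 2^-p y_{p,q(p)}. Orthogonality gives
   {a_p,b,c} = 2^-q(p) 4^-p {x,x,y}_{p,q(p)}, so that |{T a_p, T b, T c}| is
   much larger than |T a_p|, although {., T b, T c} is a bounded operator. *)

(** * Real scalars and real-valued norms over either field *)

(** Embeds the reals in the scalar field of either kind. A single real number can thus act on both
    [E] and [F], and [T] commutes with this action even when the kinds differ. *)
Definition real_scalar {R : realType} (k : scalar_kind) : R -> scalars R k :=
  match k return R -> scalars R k with
  | RealScalars => id
  | ComplexScalars => fun a => (a%:C)%C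
  end.

Lemma to_complex_real_scalar {R : realType} (k : scalar_kind) (a : R) :
  to_complex (real_scalar k a) = (a%:C)%C.
Proof. by case: k. Qed.

Lemma scalar_conj_real_scalar {R : realType} (k : scalar_kind) (a : R) :
  scalar_conj (real_scalar k a) = real_scalar k a.
Proof. by case: k => //=; rewrite /conjc /= oppr0. Qed.

Lemma real_scalarM {R : realType} (k : scalar_kind) (a b : R) :
  real_scalar k (a * b) = real_scalar k a * real_scalar k b.
Proof. by case: k => //=; rewrite rmorphM. Qed.

Lemma real_scalarD {R : realType} (k : scalar_kind) (a b : R) :
  real_scalar k (a + b) = real_scalar k a + real_scalar k b.
Proof. by case: k => //=; rewrite rmorphD. Qed.

Lemma normr_real_scalar {R : realType} (k : scalar_kind) (a : R) :
  `|real_scalar k a| = real_scalar k `|a|.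
Proof. by case: k => //=; rewrite normc_def /= expr0n addr0 sqrtr_sqr. Qed.

Lemma ler_real_scalar {R : realType} (k : scalar_kind) (a b : R) :
  (real_scalar k a <= real_scalar k b) = (a <= b).
Proof. by case: k => //=; rewrite lecR. Qed.

Lemma ltr_real_scalar {R : realType} (k : scalar_kind) (a b : R) :
  (real_scalar k a < real_scalar k b) = (a < b).
Proof. by case: k => //=; rewrite ltcR. Qed.

Lemma real_scalar_inj {R : realType} (k : scalar_kind) :
  injective (@real_scalar R k).
Proof. by move=> a b eab; apply/eqP; rewrite eq_le -!(ler_real_scalar k) eab lexx. Qed.

(** In the order on complex numbers, comparison with 0 forces the imaginary part to vanish. Norms
    and positive tolerances are therefore real scalars. *)
Lemma ge0_real_scalar {R : realType} (k : scalar_kind) (e : scalars R k) :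
  0 <= e -> e = real_scalar k (complex.Re (to_complex e)).
Proof.
case: k e => //= -[a b]; rewrite lecE /= => /andP[/eqP -> _].
by [].
Qed.

Lemma normrE {R : realType} {k : scalar_kind}
    {E : normedModType (scalars R k)} (x : E) :
  `|x| = real_scalar k (rnorm x).
Proof. exact: ge0_real_scalar. Qed.

Lemma real_scalar0 {R : realType} (k : scalar_kind) :
  real_scalar k (0 : R) = 0.
Proof. by case: k. Qed.

Lemma real_scalar1 {R : realType} (k : scalar_kind) :
  real_scalar k (1 : R) = 1.
Proof. by case: k. Qed.

Lemma rnorm_ge0 {R : realType} {k : scalar_kind}
    {E : normedModType (scalars R k)} (x : E) : 0 <= rnorm x.
Proof. by rewrite -(ler_real_scalar k) -normrE real_scalar0. Qed.

Lemma rnorm_eq0 {R : realType} {k : scalar_kind}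
    {E : normedModType (scalars R k)} (x : E) : (rnorm x == 0) = (x == 0).
Proof.
rewrite -[RHS]normr_eq0 normrE -(real_scalar0 k).
exact/esym/inj_eq/real_scalar_inj.
Qed.

Lemma ler_rnormD {R : realType} {k : scalar_kind}
    {E : normedModType (scalars R k)} (x y : E) :
  rnorm (x + y) <= rnorm x + rnorm y.
Proof. by rewrite -(ler_real_scalar k) real_scalarD -!normrE ler_normD. Qed.

Lemma rnormZ {R : realType} {k : scalar_kind}
    {E : normedModType (scalars R k)} (a : R) (x : E) :
  rnorm (real_scalar k a *: x) = `|a| * rnorm x.
Proof.
by apply: (@real_scalar_inj _ k); rewrite real_scalarM -!normrE -normr_real_scalar normrZ.
Qed.

(** * Series, bounded operators and extraction of indices *)

Lemma ler_rnorm_sum {R : realType} {k : scalar_kind}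
    {E : normedModType (scalars R k)} (u : nat -> E) (m n : nat) :
  rnorm (\sum_(m <= i < n) u i) <= \sum_(m <= i < n) rnorm (u i).
Proof.
elim/big_rec2 : _ => [|i a b _ h].
  by rewrite (eqP (_ : rnorm (0 : E) == 0)) ?rnorm_eq0.
by apply: le_trans (ler_rnormD _ _) _; rewrite lerD2l.
Qed.

(** Completeness through the Cauchy criterion: a positive tolerance in the scalar field is a real
    one, and the triangle inequality bounds each block of the series by the block of its norms. *)
Lemma cvg_series_rnorm {R : realType} {k : scalar_kind}
    {E : completeNormedModType (scalars R k)} (u : nat -> E) :
  cvgn (series (fun i => rnorm (u i))) -> cvgn (series u).
Proof.
move=> /cauchy_cvgP/cauchy_seriesP h.
apply/cauchy_cvgP/cauchy_seriesP => e e0.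
have eE := ge0_real_scalar k e (ltW e0).
move: e0; rewrite eE -(real_scalar0 k) ltr_real_scalar => /h.
apply: filterS => n /=; rewrite ger0_norm ?sumr_ge0//; last first.
  by move=> i _; exact: rnorm_ge0.
rewrite normrE ltr_real_scalar; apply: le_lt_trans.
exact: ler_rnorm_sum.
Qed.

Lemma cvg_series_geometric_rnorm {R : realType} {k : scalar_kind}
    {E : completeNormedModType (scalars R k)} (u : nat -> E) :
  (forall i, rnorm (u i) <= 2^-1 ^+ i) -> cvgn (series u).
Proof.
move=> hu; apply: cvg_series_rnorm.
apply: (@series_le_cvg _ _ (geometric 1 (2^-1 : R))).
- by move=> n; exact: rnorm_ge0.
- by move=> n; rewrite /geometric /= mul1r exprn_ge0.
- by move=> n; rewrite /geometric /= mul1r.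
apply: is_cvg_geometric_series.
by rewrite ger0_norm // invf_lt1 // ltr1n.
Qed.

(* No boundedness is needed: past index [m] the image of the partial sums is
   constant, so continuity and separation suffice. *)
Lemma continuous_additive_lim_series {K : numFieldType} {V W : normedModType K}
    (f : V -> W) (u : nat -> V) (m : nat) :
  (forall a b, f (a + b) = f a + f b) -> continuous f ->
  cvgn (series u) -> (forall i, i != m -> f (u i) = 0) ->
  f (limn (series u)) = f (u m).
Proof.
move=> fD fc cu fu.
have f0 : f 0 = 0 by apply: (@addrI _ (f 0)); rewrite -fD !addr0.
have h1 : (f \o series u) n @[n --> \oo] --> f (limn (series u)).
  by apply: continuous_cvg => //; exact: fc.
suff h2 : (f \o series u) n @[n --> \oo] --> f (u m).
  exact: (cvg_unique (@norm_hausdorff _ _) h1 h2).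
apply: cvg_near_cst.
exists m.+1 => // n /= mn.
rewrite /series /= (big_morph f fD f0) (bigD1_seq m) /= ?iota_uniq //; last first.
  by rewrite mem_index_iota.
by rewrite big1 ?addr0 // => i; exact: fu.
Qed.

Lemma continuous_linear_rnorm_bound {R : realType} {k : scalar_kind}
    {V W : normedModType (scalars R k)} (f : V -> W) :
  linear f -> continuous f ->
  exists2 M : R, 0 <= M & forall v, rnorm (f v) <= M * rnorm v.
Proof.
move=> fl fc.
pose lf := GRing.isLinear.Build _ _ _ _ f fl.
pose g : {linear V -> W} := HB.pack f lf.
have /linear_boundedP[r [rr hr]] : bounded_near g (nbhs 0).
  exact/continuous_linear_bounded/fc.
(* Boundedness near 0 makes every number strictly above [r] an admissible constant; this one is also
   nonnegative. *)
pose s := `|r| + 1.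
have s0 : 0 <= s by rewrite addr_ge0.
have rs : r < s.
  by apply: le_lt_trans (real_ler_norm rr) _; rewrite ltrDl.
have sE := ge0_real_scalar k s s0.
exists (complex.Re (to_complex s)) => [|v].
  by rewrite -(ler_real_scalar k) -sE real_scalar0.
rewrite -(ler_real_scalar k) real_scalarM -sE -!normrE.
exact: (hr s rs v).
Qed.

(** An unbounded sequence exceeds any level at arbitrarily late indices, so a strictly increasing
    [f] can be built recursively. *)
Lemma sparse_selection {R : realType} (u G : nat -> R) :
  (forall M, exists n, M < u n) ->
  exists2 f : nat -> nat, injective f & forall k, G k < u (f k).
Proof.
move=> hu.
have H (Nc : nat * R) : exists n, (Nc.1 < n)%N && (Nc.2 < u n).
  case: Nc => N c /=.
  (* Exceeding the maximum of [c] and of all values up to index [N] forces the new index past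
     [N]. *)
  have [n hn] := hu (Num.max c (\big[Num.max/c]_(i < N.+1) u i)).
  exists n; move: hn; rewrite gt_max => /andP[-> h]; rewrite andbT.
  rewrite ltnNge; apply/negP => nN; move: h; apply/negP; rewrite -leNgt.
  exact: (le_bigmax _ (fun i : 'I_N.+1 => u i) (Ordinal (nN : (n < N.+1)%N))).
have [h hP] := choice H.
pose f := fix f k := if k is j.+1 then h (f j, G k) else h (0%N, G 0%N).
have fS k : (f k < f k.+1)%N by have /andP[] := hP (f k, G k.+1).
exists f.
  exact/incn_inj/leq_mono/(homo_ltn ltn_trans).
by case=> [|k]; [have /andP[] := hP (0%N, G 0%N) | have /andP[] := hP (f k, G k.+1)].
Qed.

(** * The triple product one variable at a time *)

Section TripleProduct.
Context {R : realType} {E : jordanBanachTriple R}.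
Implicit Types (x y z : E) (a : R).

Lemma tprodDl y z : {morph (fun x => tprod x y z) : x x' / x + x'}.
Proof. by move=> x x'; have := tprod_linear_left y z 1 x x'; rewrite !scale1r. Qed.

Lemma tprodDm x z : {morph (fun y => tprod x y z) : y y' / y + y'}.
Proof.
move=> y y'; have := tprod_conj_linear_middle x z (real_scalar (jbt_kind E) 1) y y'.
by rewrite scalar_conj_real_scalar real_scalar1 !scale1r.
Qed.

Lemma tprodDr x y : {morph tprod x y : z z' / z + z'}.
Proof. by move=> z z'; have := tprod_linear_right x y 1 z z'; rewrite !scale1r. Qed.

Lemma tprod0m x z : tprod x 0 z = 0.
Proof. by apply: (@addrI _ (tprod x 0 z)); rewrite -tprodDm !addr0. Qed.

Lemma tprodZl a x y z :
  tprod (real_scalar _ a *: x) y z = real_scalar _ a *: tprod x y z.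
Proof. exact: (scalable_linear (tprod_linear_left y z)). Qed.

Lemma tprodZr a x y z :
  tprod x y (real_scalar _ a *: z) = real_scalar _ a *: tprod x y z.
Proof. exact: (scalable_linear (tprod_linear_right x y)). Qed.

(** Conjugation fixes real scalars, so they leave the middle variable exactly as they leave the
    outer ones. *)
Lemma tprodZm a x y z :
  tprod x (real_scalar _ a *: y) z = real_scalar _ a *: tprod x y z.
Proof.
have := tprod_conj_linear_middle x z (real_scalar (jbt_kind E) a) y 0.
by rewrite scalar_conj_real_scalar tprod0m !addr0.
Qed.

Lemma continuous_tprodl y z : continuous (fun x => tprod x y z).
Proof.
move=> x; apply: (@continuous_comp _ _ _ (fun x => (x, y, z))
  (fun p : E * E * E => tprod p.1.1 p.1.2 p.2)); last exact: tprod_continuous.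
exact: (cvg_pair (cvg_pair cvg_id (cvg_cst y)) (cvg_cst z)).
Qed.

Lemma continuous_tprodm x z : continuous (fun y => tprod x y z).
Proof.
move=> y; apply: (@continuous_comp _ _ _ (fun y => (x, y, z))
  (fun p : E * E * E => tprod p.1.1 p.1.2 p.2)); last exact: tprod_continuous.
exact: (cvg_pair (cvg_pair (cvg_cst x) cvg_id) (cvg_cst z)).
Qed.

Lemma continuous_tprodr x y : continuous (tprod x y).
Proof.
move=> z; apply: (@continuous_comp _ _ _ (fun z => (x, y, z))
  (fun p : E * E * E => tprod p.1.1 p.1.2 p.2)); last exact: tprod_continuous.
exact: (cvg_pair (cvg_cst (x, y)) cvg_id).
Qed.

Lemma orthogonal_eltsZ a b x y : orthogonal_elts x y ->
  orthogonal_elts (real_scalar _ a *: x) (real_scalar _ b *: y).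
Proof.
by move=> [xy yx]; split=> z; rewrite /Lop tprodZl tprodZm;
   [have := xy z | have := yx z]; rewrite /Lop => ->; rewrite !scaler0.
Qed.

End TripleProduct.

(** * The gliding hump *)

(** The unit bounds make the series with weights [2^-1 ^+ i] converge absolutely. [T] is never moved
    inside a limit: it is applied only to the identity for [{a_p, b, c}], and continuity enters
    through the products of [E] and [F]. *)
Lemma triple_homomorphism_bounded_unit {R : realType} {E F : jordanBanachTriple R}
    {T : E -> F} {x y : nat -> E} :
  triple_homomorphism T ->
  (forall n, rnorm (x n) <= 1) -> (forall n, rnorm (y n) <= 1) ->
  (forall n m, n <> m -> orthogonal_elts (x n) (x m)) ->
  (forall n m, n <> m -> orthogonal_elts (x n) (y m)) ->
  exists M, forall n, rnorm (T (tprod (x n) (x n) (y n))) <= M.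
Proof.
move=> [[_ TZ] TM] hx hy hxx hxy; apply: contrapT => nb.
pose u n := rnorm (T (tprod (x n) (x n) (y n))).
have {nb} hu M : exists n, M < u n.
  apply: contrapT => nM; apply: nb; exists M => n; rewrite leNgt.
  by apply/negP => Mn; apply: nM; exists n.
pose h i : R := 2^-1 ^+ i.
have h0 i : 0 < h i by rewrite exprn_gt0.
(* The denominator is the weight that [{a_p, b, c}] will carry when [q(p) = q]; once it cancels, a
   lower bound [p * q] remains. *)
pose G pq : R := pq.1%:R * pq.2%:R / (h pq.2 * h pq.1 * h pq.1).
(* Pairs are coded by natural numbers; a number coding no pair gets the harmless level 0.
   Injectivity of [f] gives distinct pairs distinct indices, hence orthogonal vectors. *)
have [f finj fG] := sparse_selection u
  (fun i => if unpickle i is Some pq then G pq else 0) hu.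
pose n (p q : nat) := f (pickle (p, q)).
have nG p q : G (p, q) < u (n p q).
  by have := fG (pickle (p, q)); rewrite pickleK.
have ninj p q p' q' : n p q = n p' q' -> (p, q) = (p', q').
  by move=> /finj /(pcan_inj pickleK).
pose w i := real_scalar (jbt_kind E) (h i).
have cvgw (v : nat -> E) : (forall i, rnorm (v i) <= 1) ->
    cvgn (series (fun i => w i *: v i)).
  move=> hv; apply: cvg_series_geometric_rnorm => i.
  by rewrite rnormZ gtr0_norm // ler_piMr // ltW.
pose a p := limn (series (fun q => w q *: x (n p q))).
(* A natural number strictly above the norm of [T (a p)], chosen before [b] and [c] are formed. *)
pose q p := Num.bound (rnorm (T (a p))).
pose r p := n p (q p).
pose b := limn (series (fun p => w p *: x (r p))).
pose c := limn (series (fun p => w p *: y (r p))).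
have rinj p p' : p' != p -> r p <> r p'.
  by move=> /eqP pp' /ninj[e _]; apply: pp'.
(* The variables collapse in the order middle, left, right. As [a p] is built from row [p] only,
   just the [p]-th term of [b] survives; [x (r p)] then isolates one term of [a p] and one of
   [c]. *)
have abc p : tprod (a p) b c =
    real_scalar _ (h (q p) * h p * h p) *: tprod (x (r p)) (x (r p)) (y (r p)).
  have left0 i j z : i != p -> tprod (w j *: x (n p j)) (x (r i)) z = 0.
    move=> ip; rewrite tprodZl.
    have /hxx[h1 _] : n p j <> r i.
      by move=> /ninj[pi _]; rewrite pi eqxx in ip.
    by have := h1 z; rewrite /Lop => ->; rewrite scaler0.
  have stepm : tprod (a p) b c = w p *: tprod (a p) (x (r p)) c.
    rewrite -tprodZm.
    apply: (continuous_additive_lim_series (fun y => tprod (a p) y c) _ p).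
    - exact: tprodDm.
    - exact: continuous_tprodm.
    - exact: cvgw.
    move=> i ip; rewrite tprodZm.
    suff -> : tprod (a p) (x (r i)) c = 0 by rewrite scaler0.
    (* Here every term of the series for [a p] is killed, so the distinguished index 0 is
       arbitrary. *)
    rewrite (continuous_additive_lim_series (fun y => tprod y (x (r i)) c) _ 0).
    + exact: left0.
    + exact: tprodDl.
    + exact: continuous_tprodl.
    + exact: cvgw.
    by move=> j _; exact: left0.
  have stepl : tprod (a p) (x (r p)) c = w (q p) *: tprod (x (r p)) (x (r p)) c.
    rewrite -tprodZl.
    apply: (continuous_additive_lim_series (fun y => tprod y (x (r p)) c) _ (q p)).
    - exact: tprodDl.
    - exact: continuous_tprodl.
    - exact: cvgw.
    move=> j jq; rewrite tprodZl.
    have /hxx[h1 _] : n p j <> r p.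
      by move=> /ninj[e]; rewrite e eqxx in jq.
    by have := h1 c; rewrite /Lop => ->; rewrite scaler0.
  have stepr : tprod (x (r p)) (x (r p)) c =
      w p *: tprod (x (r p)) (x (r p)) (y (r p)).
    rewrite -tprodZr.
    apply: (continuous_additive_lim_series (tprod (x (r p)) (x (r p))) _ p).
    - exact: tprodDr.
    - exact: continuous_tprodr.
    - exact: cvgw.
    (* Symmetry brings [y (r i)] to the left, where the operator [L(y (r i), x (r p))] vanishes. *)
    move=> i ip; rewrite tprodZr tprod_sym.
    have /hxy[_ h1] : r p <> r i by exact: rinj.
    by have := h1 (x (r p)); rewrite /Lop => ->; rewrite scaler0.
  rewrite stepm stepl stepr !scalerA -!real_scalarM.
  by rewrite [h p * h (q p)]mulrC.
(* With [b] and [c] fixed, [M] does not depend on [p]. *)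
have [M M0 hM] : exists2 M : R, 0 <= M &
    forall v, rnorm (tprod v (T b) (T c)) <= M * rnorm v.
  apply: (continuous_linear_rnorm_bound (fun v => tprod v (T b) (T c))).
    exact: tprod_linear_left.
  exact: continuous_tprodl.
have main p : p%:R * (q p)%:R < M * rnorm (T (a p)).
  apply: lt_le_trans (hM _); rewrite -TM abc.
  rewrite (TZ _ (real_scalar _ (h (q p) * h p * h p))) ?to_complex_real_scalar //.
  rewrite rnormZ gtr0_norm ?mulr_gt0 // -ltr_pdivrMl ?mulr_gt0 // mulrC.
  exact: nG.
(* Now [p] exceeds [M] and [q p] exceeds the norm of [T (a p)], so the product contradicts
   [main p]. *)
pose p := Num.bound M.
have := main p; apply/negP; rewrite -leNgt.
apply: ler_pM => //; first exact: rnorm_ge0.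
  exact/ltW/archi_boundP.
by apply/ltW/archi_boundP; exact: rnorm_ge0.
Qed.

Theorem theorem12 (R : realType) (E F : jordanBanachTriple R) (T : E -> F)
    (hT : triple_homomorphism T) (x y : nat -> E)
    (hx : forall n, x n != 0) (hy : forall n, y n != 0)
    (hxx : forall n m, n <> m -> orthogonal_elts (x n) (x m))
    (hxy : forall n m, n <> m -> orthogonal_elts (x n) (y m)) :
  (ereal_sup
     (range (fun n : nat =>
        (rnorm (T (tprod (x n) (x n) (y n)))
           / (rnorm (x n) ^+ 2 * rnorm (y n)))%:E)) < +oo)%E.
Proof.
pose x' n := real_scalar _ (rnorm (x n))^-1 *: x n.
pose y' n := real_scalar _ (rnorm (y n))^-1 *: y n.
have unit_le1 (v : E) : rnorm (real_scalar _ (rnorm v)^-1 *: v) <= 1.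
  rewrite rnormZ ger0_norm ?invr_ge0 ?rnorm_ge0 //.
  by have [->|v0] := eqVneq (rnorm v) 0; rewrite ?mulr0 // mulVf.
have [M hM] : exists M, forall n, rnorm (T (tprod (x' n) (x' n) (y' n))) <= M.
  apply: (triple_homomorphism_bounded_unit hT) => [n|n|n m nm|n m nm].
  - exact: unit_le1.
  - exact: unit_le1.
  - exact/orthogonal_eltsZ/hxx.
  - exact/orthogonal_eltsZ/hxy.
apply: (@le_lt_trans _ _ M%:E); last exact: ltry.
apply/ereal_supP => _ [n _ <-]; rewrite lee_fin.
apply: le_trans (hM n); rewrite /x' /y' tprodZl tprodZm tprodZr !scalerA -!real_scalarM.
have [[_ TZ] _] := hT.
(* [s] collects the inverse norms taken out of the three variables; moved through [T], it turns the
   bound [M] into one for the quotient itself. *)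
set s := (X in real_scalar _ X); rewrite (TZ _ (real_scalar _ s)) ?to_complex_real_scalar //.
rewrite rnormZ ger0_norm ?mulr_ge0 ?invr_ge0 ?rnorm_ge0 //.
by rewrite /s mulrC expr2 !invfM.
Qed.
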